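(* For every positive integer $N$, the linear system $$\gamma_N^{a,a}-\lambda_N^{a,a}=\tilde g^{a}_2(q)\quad\forall a\in\mathbb{Z}/N\mathbb{Z},\qquad \gamma_N^{a,b}+\gamma_N^{b,a}-2\lambda_N^{a,b}=0\quad\forall a\ne b\in\mathbb{Z}/N\mathbb{Z},$$ $$\gamma_N^{a+b,a}+\gamma_N^{a+b,b}-2\lambda_N^{a,b}=f^{a}_{2}(q)+f^{b}_{2}(q)\quad\forall a,b\in\mathbb{Z}/N\mathbb{Z}$$ in the unknowns $\gamma_N^{a,b}$ and $\lambda_N^{a,b}=\lambda_N^{b,a}$ ($0\le a,b<N$) has infinitely many sets of solutions in terms of (i.e. given by linear combinations of) the series $f_2^a(q)$ and $\tilde g_2^a(q)$ ($0\le a<N$). Moreover, one can always choose $$\{\gamma_N^{a,b}:0\le b<a<N\}\cup\{\gamma_N^{N-a,N-a}:1\le a\le N,\ a\mid N\}$$ as the $N(N-1)/2+\nu(N)$ free variables.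
   Context: Let $\eta=e^{2\pi i/N}$. Superscripts are residue classes modulo $N$, represented by integers in $\{0,\dots,N-1\}$. $\nu(N)$ is the number of positive divisors of $N$ (including $1$ and $N$). For $a\in\mathbb{Z}/N\mathbb{Z}$, $$\tilde g_2^a(q)=\frac1{N^2}\sum_{n,u\ge1}\eta^{au}u\,q^{nu},\qquad f_2^a(q)=\frac1{N^2}\sum_{n,u\ge1}\eta^{au}n\,q^{nu},$$ as power series in $q$. The unknowns are power series in $q$. ''Free variables'' has its usual linear-algebra meaning: these unknowns can be assigned arbitrary values, and then the remaining unknowns are uniquely determined by the system. *)

(* Defs.v *)
From mathcomp Require Import all_boot all_order all_algebra.
From mathcomp Require Import all_classical all_reals all_analysis.
From mathcomp Require Import complex.
Set Implicit Arguments.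
Unset Strict Implicit.
Unset Printing Implicit Defensive.
Import Order.TTheory GRing.Theory Num.Theory.
Local Open Scope ring_scope.
Local Open Scope complex_scope.

(* Formal power series in q over the complex numbers, as coefficient
   sequences; only their linear structure is needed, and it is the pointwise
   one on functions. *)
Definition qseries (R : realType) : Type := nat -> R[i].

(* The double series sum_{n, u >= 1} c n u q^(n u); a pair with n * u = m >= 1
   satisfies n, u <= m, so every coefficient is a finite sum. *)
Definition lambert (R : realType) (c : nat -> nat -> R[i]) : qseries R :=
  fun m => \sum_(1 <= n < m.+1) \sum_(1 <= u < m.+1 | (n * u == m)%N) c n u.

Definition eta (R : realType) (N : nat) : R[i] :=
  cos (2 * pi / N%:R) +i* sin (2 * pi / N%:R).

(* Residue classes modulo N >= 1 are elements of 'I_n.+1 with N = n.+1: this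
   type carries the addition modulo n.+1 (also for n = 0, unlike 'Z_1) and
   coerces to the representatives 0, ..., n. *)
Definition gtilde2 (R : realType) (n : nat) (a : 'I_n.+1) : qseries R :=
  lambert (fun _ u => eta R n.+1 ^+ (a * u) * u%:R / n.+1%:R ^+ 2).

Definition f2 (R : realType) (n : nat) (a : 'I_n.+1) : qseries R :=
  lambert (fun k u => eta R n.+1 ^+ (a * u) * k%:R / n.+1%:R ^+ 2).

Definition unknowns (R : realType) (n : nat) : Type :=
  'I_n.+1 -> 'I_n.+1 -> qseries R.

Definition is_solution (R : realType) (n : nat)
    (gamma lambda : unknowns R n) : Prop :=
  [/\ forall a b, lambda a b = lambda b a,
      forall a, gamma a a - lambda a a = gtilde2 R a,
      forall a b, a != b -> gamma a b + gamma b a - lambda a b *+ 2 = 0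
    & forall a b, gamma (a + b) a + gamma (a + b) b - lambda a b *+ 2
                  = f2 R a + f2 R b].

Definition in_span_fg (R : realType) (n : nat) (x : qseries R) : Prop :=
  exists c d : 'I_n.+1 -> R[i], forall m,
    x m = \sum_a (c a * f2 R a m + d a * gtilde2 R a m).

(* The pairs (a, b) with b < a, and (N-d, N-d) for the positive divisors d of
   N = n.+1. *)
Definition free_index (n : nat) : pred ('I_n.+1 * 'I_n.+1) :=
  fun p => (p.2 < p.1)%N ||
    has (fun d => (p.1 == n.+1 - d :> nat)%N && (p.2 == n.+1 - d :> nat)%N)
        (divisors n.+1).

(* Main.v *)
From HB Require Import structures.
Require Import Defs.
From mathcomp Require Import all_boot all_order all_algebra.
From mathcomp Require Import all_classical all_reals all_analysis.
From mathcomp Require Import complex ring lra zify.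
Set Implicit Arguments.
Unset Strict Implicit.
Unset Printing Implicit Defensive.
Import Order.TTheory GRing.Theory Num.Theory.
Local Open Scope classical_set_scope.
Local Open Scope complex_scope.
Local Open Scope ring_scope.

(* Write N = n.+1. Eliminating lambda leaves one equation
   gamma(a+b,a) + gamma(a+b,b) - gamma(a,b) - gamma(b,a) = (known series) for
   every unordered pair {a, b}, whose left side is [defect gamma a b]. Discard
   the equations at (a, b) = (-d, -d) with d | N: exactly as many equations are
   left as there are non-free gammas. The resulting square system is invertible,
   because an upper entry gamma(b,a) with b < a is computed by a descent that
   preserves gcd(N-b, N-a) and only involves a diagonal entry gamma(x,x) when
   this gcd divides N.
   The discarded equations are consequences of the others: for a subgroup H of
   Z/N the sum over a, b in H of the left sides vanishes identically, and so
   does that of the right sides because |H| sum_H f_2 = sum_H g~_2, which is the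
   symmetry n <-> u of the double series once the roots of unity are summed.
   Everything is done coefficient by coefficient in q. *)

(** * Defects and the free positions *)

Definition defect (V : zmodType) (n : nat) (h : 'I_n.+1 * 'I_n.+1 -> V)
    (a b : 'I_n.+1) : V :=
  h (a + b, a) + h (a + b, b) - h (a, b) - h (b, a).

Lemma defectC (V : zmodType) (n : nat) (h : 'I_n.+1 * 'I_n.+1 -> V)
    (a b : 'I_n.+1) :
  defect h a b = defect h b a.
Proof.
by rewrite /defect [b + a]addrC [h (a + b, b) + _]addrC addrAC.
Qed.

Lemma free_diagP (n : nat) (a : 'I_n.+1) :
  reflect (exists2 d, (d %| n.+1)%N & a = (n.+1 - d)%N :> nat)
          (free_index (a, a)).
Proof.
rewrite /free_index /= ltnn /=; apply: (iffP hasP) => -[d].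
  by rewrite -dvdn_divisors// andbb => dn /eqP; exists d.
by move=> dn ea; exists d; rewrite -?dvdn_divisors// ea eqxx.
Qed.

Lemma free_neq (n : nat) (a b : 'I_n.+1) :
  a != b -> free_index (a, b) = (b < a)%N.
Proof.
move=> ab; rewrite /free_index /=; case: hasP => [[d _ /andP[/eqP ea /eqP eb]]|].
  by move/eqP: ab; case; apply: val_inj; rewrite /= ea eb.
by rewrite orbF.
Qed.

Lemma val_addI (n : nat) (a b : 'I_n.+1) : (a + b <= n)%N ->
  val (a + b) = (a + b)%N.
Proof. by move=> abn; rewrite /= modn_small. Qed.

Lemma val_addI_carry (n : nat) (a b : 'I_n.+1) : (n < a + b)%N ->
  val (a + b) = (a + b - n.+1)%N.
Proof.
move=> nab; rewrite /= -[X in (X %% _)%N](subnK nab) modnDr modn_small//.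
by have := ltn_ord a; have := ltn_ord b; lia.
Qed.

(** * Invertibility of the square system *)

Section kernel.
Variables (K : numFieldType) (n : nat) (h : 'I_n.+1 * 'I_n.+1 -> K).
Hypothesis h_free : forall p, free_index p -> h p = 0.
Hypothesis h_defect : forall p, ~~ free_index p -> defect h p.1 p.2 = 0.

Let h_low (a b : 'I_n.+1) : (b < a)%N -> h (a, b) = 0.
Proof. by move=> ba; apply: h_free; rewrite /free_index /= ba. Qed.

Let h_up (b a : 'I_n.+1) : (b < a)%N ->
  h (b, a) = h (b + a, b) + h (b + a, a).
Proof.
move=> ba; have /h_defect : ~~ free_index (b, a).
  by rewrite free_neq -1?leqNgt 1?ltnW//; apply: contraTneq ba => ->; rewrite ltnn.
by rewrite /defect /= (h_low ba) subr0 => /eqP; rewrite subr_eq0 => /eqP.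
Qed.

(* The descent (b, a) -> (a + b - N, -) preserves gcd(N - b, N - a) and ends
   either below the diagonal or at (0, x), where the equation for (0, x)
   expresses h (0, x) by h (x, x) and where the gcd divides N. *)
Let h_up0 (b a : 'I_n.+1) : (b < a)%N ->
  (forall x, h (x, x) = 0) \/ ~~ (gcdn (n.+1 - b) (n.+1 - a) %| n.+1)%N ->
  h (b, a) = 0.
Proof.
move: {2}(b : nat) (leqnn b) => k; elim: k b a => [|k IH] b a bk ba H.
  have b0 : b = 0 by apply: val_inj => /=; lia.
  rewrite h_up// b0 add0r h_low; last by rewrite -b0.
  by case: H => [->|]; rewrite ?addr0// b0 subn0 dvdn_gcdl.
rewrite h_up//; have lta := ltn_ord a; case: (leqP (b + a) n) => ban.
  have [b0|b0] := posnP b.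
    by rewrite -h_up//; apply: IH => //; lia.
  by rewrite !h_low ?addr0// val_addI//; lia.
(* With a carry, a + b - N is smaller than both a and b, so both terms lie above the diagonal in an
   earlier row. The gcd is preserved since N - (x + y - N) = (N - x) + (N - y). *)
have E := val_addI_carry ban.
have Eg x y : (x <= n)%N -> (y <= n)%N -> (n < x + y)%N ->
    gcdn (n.+1 - (x + y - n.+1)) (n.+1 - y) = gcdn (n.+1 - x) (n.+1 - y).
  move=> xn yn nxy.
  have -> : (n.+1 - (x + y - n.+1) = (n.+1 - x) + (n.+1 - y))%N by lia.
  by rewrite gcdnC gcdnDr gcdnC.
have hb : h (b + a, b) = 0.
  apply: IH; rewrite ?E; [by lia | by lia |].
  case: H => [|H]; [by left | right].
  by rewrite [(b + a)%N]addnC Eg 1?addnC 1?gcdnC//; lia.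
have ha : h (b + a, a) = 0.
  apply: IH; rewrite ?E; [by lia | by lia |].
  by case: H => [|H]; [left | right; rewrite Eg//; lia].
by rewrite hb ha addr0.
Qed.

(** At a non-free (a, a) the equation reads 2 h(2a, a) = 2 h(a, a), and a > 0. Without a carry, (2a,
    a) is below the diagonal. With one, it is above, and the gcd of the descent is N - a, which does
    not divide N precisely because (a, a) is not free. *)
Let h_diag (a : 'I_n.+1) : h (a, a) = 0.
Proof.
have [/h_free//|nf] := boolP (free_index (a, a)).
have /eqP := h_defect nf; rewrite /defect /= -mulr2n -addrA -opprD -mulr2n.
rewrite -mulrnBl mulrn_eq0 /= subr_eq0 => /eqP <-.
have a0 : (0 < a)%N.
  rewrite lt0n; apply: contra nf => /eqP a0.
  by apply/free_diagP; exists n.+1; rewrite // a0 subnn.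
have lta := ltn_ord a; have [aan|naa] := leqP (a + a) n.
  by rewrite h_low// val_addI//; lia.
have E := val_addI_carry naa.
apply: h_up0; [by rewrite E; lia|right; rewrite E; apply: contra nf => dn].
apply/free_diagP; exists (n.+1 - a)%N; last by lia.
have E2 : (n.+1 - (a + a - n.+1) = (n.+1 - a) + (n.+1 - a))%N by lia.
by move: dn; rewrite E2 gcdnC gcdnDr gcdnn.
Qed.

Lemma defect_kernel p : h p = 0.
Proof.
case: p => b a; case: (ltngtP b a) => [ba|/h_low//|/val_inj->]//.
by apply: h_up0 => //; left.
Qed.

End kernel.

(** An injective endomorphism of a finite-dimensional space is invertible. Keeping the inverse as a
    linear map lets the span statement follow from linearity. *)
Lemma solution_operator (K : numFieldType) (n : nat) :
  exists S : 'End({ffun 'I_n.+1 * 'I_n.+1 -> K^o}), forall x,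
    (forall p, free_index p -> S x p = x p) /\
    (forall p, ~~ free_index p -> defect (S x) p.1 p.2 = x p).
Proof.
pose T (h : {ffun 'I_n.+1 * 'I_n.+1 -> K^o}) : {ffun 'I_n.+1 * 'I_n.+1 -> K^o} :=
  [ffun p => if free_index p then h p else defect h p.1 p.2].
have T_lin : linear T.
  move=> c h k; apply/ffunP => p; rewrite !ffunE /defect !ffunE.
  by case: ifP => // _; rewrite !scalerBr scalerDr; ring.
pose TL := GRing.isLinear.Build _ _ _ _ T T_lin.
pose Tl : {linear _ -> _} := HB.pack T TL.
have TE h : linfun Tl h = T h by rewrite lfunE.
have kerT : lker (linfun Tl) == 0%VS.
  rewrite -subv0; apply/subvP => h; rewrite memv_ker TE memv0 => /eqP Th0.
  apply/eqP/ffunP => p; rewrite ffunE.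
  apply: (@defect_kernel K n h) => q fq;
    have := congr1 (fun k : {ffun _} => k q) Th0.
    by rewrite !ffunE fq.
  by rewrite !ffunE (negbTE fq).
exists (linfun Tl)^-1%VF => x; have := TE ((linfun Tl)^-1%VF x).
rewrite lker0_lfunVK// => /ffunP Ex.
by split=> p fp; rewrite [RHS]Ex ffunE ?fp// (negbTE fp).
Qed.

(** * Sums over subgroups and the discarded equations *)

Lemma dvdn_addI (n d : nat) (a b : 'I_n.+1) : (d %| n.+1)%N -> (d %| a)%N ->
  (d %| (a + b)%R)%N = (d %| b)%N.
Proof.
by move=> dn da; rewrite /= /dvdn modn_dvdm// -/(dvdn _ _) dvdn_addr.
Qed.

Lemma sum_shift_dvd (V : zmodType) (n d : nat) (a : 'I_n.+1)
    (F : 'I_n.+1 -> V) : (d %| n.+1)%N -> (d %| a)%N ->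
  \sum_(b < n.+1 | (d %| b)%N) F (a + b) = \sum_(b < n.+1 | (d %| b)%N) F b.
Proof.
move=> dn da; rewrite [RHS](reindex_inj (addrI a)) /=.
by apply: eq_bigl => b; rewrite dvdn_addI.
Qed.

(* Up to reordering, the sum of [h (a + b, a)] over a subgroup is that of
   [h (a, b)]: these are the row dependencies of the linear system. *)
Lemma sum_defect (V : zmodType) (n d : nat) (h : 'I_n.+1 * 'I_n.+1 -> V) :
  (d %| n.+1)%N ->
  \sum_(a < n.+1 | (d %| a)%N) \sum_(b < n.+1 | (d %| b)%N) defect h a b = 0.
Proof.
move=> dn.
pose H := \sum_(a < n.+1 | (d %| a)%N) \sum_(b < n.+1 | (d %| b)%N) h (a, b).
have HC : \sum_(a < n.+1 | (d %| a)%N) \sum_(b < n.+1 | (d %| b)%N) h (b, a) = H.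
  by rewrite exchange_big.
have H1 : \sum_(a < n.+1 | (d %| a)%N) \sum_(b < n.+1 | (d %| b)%N) h (a + b, a) = H.
  rewrite -HC; apply: eq_bigr => a da.
  exact: (sum_shift_dvd (fun b => h (b, a)) dn da).
have H2 : \sum_(a < n.+1 | (d %| a)%N) \sum_(b < n.+1 | (d %| b)%N) h (a + b, b) = H.
  rewrite -H1 exchange_big; apply: eq_bigr => a da.
  by apply: eq_bigr => b db; rewrite addrC.
under eq_bigr do rewrite /defect !sumrB big_split.
by rewrite !sumrB big_split H1 H2 HC /= -/H addrK subrr.
Qed.

(** Strong induction on a free diagonal position a = N - d. In the sum over the subgroup of
    multiples of d, every equation except the one at (a, a) is already known, so the vanishing of
    both totals forces that one too. *)
Lemma defect_complete (V : zmodType) (n : nat) (h : 'I_n.+1 * 'I_n.+1 -> V)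
    (r : 'I_n.+1 -> 'I_n.+1 -> V) :
  (forall a b, r a b = r b a) ->
  (forall d, (d %| n.+1)%N ->
    \sum_(a < n.+1 | (d %| a)%N) \sum_(b < n.+1 | (d %| b)%N) r a b = 0) ->
  (forall p, ~~ free_index p -> defect h p.1 p.2 = r p.1 p.2) ->
  forall a b, defect h a b = r a b.
Proof.
move=> rC r_sum h_eq.
have h_neq a b : a != b -> defect h a b = r a b.
  move=> ab; have [alb|bla|/val_inj eab] := ltngtP a b;
    last by rewrite eab eqxx in ab.
    by apply: (h_eq (a, b)); rewrite free_neq// -leqNgt ltnW.
  rewrite defectC rC; apply: (h_eq (b, a)).
  by rewrite free_neq 1?eq_sym// -leqNgt ltnW.
suff h_diag a : defect h a a = r a a.
  by move=> a b; have [->|/h_neq] := eqVneq a b.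
move: {2}(a : nat) (leqnn a) => k; elim/ltn_ind: k a => k IH a ak.
have [/free_diagP[d dn ea]|/h_eq//] := boolP (free_index (a, a)).
have lta := ltn_ord a.
have da : (d %| a)%N by rewrite ea dvdn_sub.
have : \sum_(b < n.+1 | (d %| b)%N) \sum_(c < n.+1 | (d %| c)%N)
    (defect h b c - r b c) = 0.
  by under eq_bigr do rewrite sumrB; rewrite sumrB sum_defect// r_sum// subr0.
rewrite (bigD1 a da) /= [X in _ + X]big1 ?addr0; last first.
  move=> b /andP[db ba]; rewrite big1// => c dc; apply/eqP; rewrite subr_eq0.
  have [ebc|/h_neq->//] := eqVneq b c; rewrite -ebc; apply/eqP.
  have [/free_diagP[e en eb]|/h_eq//] := boolP (free_index (b, b)).
  (* N - d is the largest multiple of d below N, so any other diagonal position of the subgroup is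
     covered by the induction. *)
  have bla : (b < a)%N.
    have de : (d %| e)%N.
      rewrite -(subKn (dvdn_leq (ltn0Sn n) en)) -eb dvdn_subr//.
      by rewrite ltnW.
    have e0 : (0 < e)%N := dvdn_gt0 (ltn0Sn n) en.
    have led := dvdn_leq e0 de; have len := dvdn_leq (ltn0Sn n) en.
    move: ba; rewrite -val_eqE /= => ba.
    by clear -led len ba ea eb; lia.
  exact: (IH b (leq_trans bla ak)).
rewrite (bigD1 a da) /= [X in _ + X]big1 ?addr0; first by move/subr0_eq.
by move=> b /andP[db ba]; rewrite h_neq ?subrr// eq_sym.
Qed.

(** * Roots of unity and the relation between [f2] and [gtilde2] *)

Lemma eta_exp (R : realType) (N k : nat) :
  eta R N ^+ k = cos (2 * pi / N%:R * k%:R) +i* sin (2 * pi / N%:R * k%:R).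
Proof.
elim: k => [|k IH]; first by rewrite expr0 mulr0 cos0 sin0.
rewrite exprSr IH /eta; set t := 2 * pi / N%:R.
have -> : t * k.+1%:R = t * k%:R + t by rewrite -[k.+1%:R]natr1; ring.
rewrite cosD sinD.
by apply/eqP; rewrite eq_complex /=; apply/andP; split; apply/eqP; ring.
Qed.

Lemma eta_order (R : realType) (N : nat) : (0 < N)%N -> eta R N ^+ N = 1.
Proof.
move=> N0; rewrite eta_exp divfK ?pnatr_eq0 -?lt0n// mulrC mulr_natr.
by rewrite cos2pi sin2pi.
Qed.

Lemma eta_expr_eq1 (R : realType) (N k : nat) : (0 < N)%N ->
  (eta R N ^+ k == 1) = (N %| k)%N.
Proof.
move=> N0; apply/idP/idP => [|/dvdnP[j ->]]; last first.
  by rewrite mulnC exprM eta_order// expr1n.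
rewrite -(expr_mod k (eta_order R N0)) /dvdn => /eqP.
have [//|r0] := posnP (k %% N); have rN := ltn_pmod k N0.
rewrite eta_exp => /(congr1 (@complex.Re R)) /=.
(* Half the angle: 0 < y < pi gives sin y > 0, hence cos 2y < 1. *)
set y : R := pi / N%:R * (k %% N)%:R.
have -> : 2 * pi / N%:R * (k %% N)%:R = y *+ 2 by rewrite /y; ring.
have y0 : 0 < y by rewrite mulr_gt0 ?divr_gt0 ?pi_gt0 ?ltr0n.
have ypi : y < pi.
  rewrite /y mulrAC ltr_pdivrMr ?ltr0n// ltr_pM2l ?pi_gt0//.
  by rewrite ltr_nat.
have := sin_gt0_pi (introT andP (conj y0 ypi)).
have := cos2Dsin2 y; rewrite cos_mulr2n; move: (cos y) (sin y) => c s cs s0 c1.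
have := exprn_gt0 2 s0; lra.
Qed.

Lemma count_dvd_ord (n d : nat) : (d %| n.+1)%N ->
  (\sum_(a < n.+1 | d %| a) 1 = n.+1 %/ d)%N.
Proof.
move=> dn; rewrite big_mkcond /= divn_count_dvd; apply: (@addIn 1%N).
have <- : (\sum_(0 <= i < n.+2) (d %| i) = \sum_(1 <= i < n.+2) (d %| i) + 1)%N.
  by rewrite big_ltn// dvdn0 addnC.
by rewrite big_nat_recr//= dn big_mkord.
Qed.

Lemma sum_eta_dvd (R : realType) (n d u : nat) : (d %| n.+1)%N ->
  \sum_(a < n.+1 | (d %| a)%N) eta R n.+1 ^+ (a * u) =
    if (n.+1 %/ d %| u)%N then (n.+1 %/ d)%:R else 0.
Proof.
move=> dn; have eN := eta_order R (ltn0Sn n).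
have eqN : (d * (n.+1 %/ d) = n.+1)%N by rewrite mulnC divnK.
case: ifPn => Mu.
  rewrite -(count_dvd_ord dn) natr_sum; apply: eq_bigr => a da.
  by apply/eqP; rewrite eta_expr_eq1// -{1}eqN dvdn_mul.
(* If d = N the quotient is 1, which divides u; so here d is a genuine residue. *)
have ltd : (d < n.+1)%N.
  rewrite ltn_neqAle dvdn_leq// andbT; apply: contra Mu => /eqP ->.
  by rewrite divnn dvd1n.
pose d' : 'I_n.+1 := Ordinal ltd.
pose F (a : 'I_n.+1) := eta R n.+1 ^+ (a * u).
(* Translation by d multiplies the sum by eta^(d u), which is not 1, so the sum is 0. *)
have := sum_shift_dvd F dn (dvdnn d : (d %| d')%N).
have FD b : F (d' + b) = eta R n.+1 ^+ (d * u) * F b.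
  by rewrite /F /= exprM expr_mod// -exprM mulnDl exprD.
under eq_bigr do rewrite FD.
rewrite -mulr_sumr => /eqP; rewrite -subr_eq0 -[X in _ - X]mul1r -mulrBl.
rewrite mulf_eq0 subr_eq0 eta_expr_eq1// -{1}eqN dvdn_pmul2l ?(dvdn_gt0 _ dn)//.
by rewrite (negbTE Mu) => /eqP.
Qed.

Lemma lambertE (R : realType) (c : nat -> nat -> R[i]) (m : nat) :
  lambert c m = \sum_(p : 'I_m.+1 * 'I_m.+1 |
    [&& 0 < p.1, 0 < p.2 & p.1 * p.2 == m]%N) c p.1 p.2.
Proof.
rewrite /lambert (big_nat_widenl _ 0)// big_mkord.
under eq_bigr do rewrite (big_nat_widenl 1 0)// big_mkord.
rewrite pair_big_dep; apply: eq_bigl => p /=.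
by rewrite [(_ == _) && _]andbC.
Qed.

(* The two sides are exchanged by (k, M u) |-> (u, M k). *)
Lemma sum_dvd_swap (V : nmodType) (m M : nat) (F : nat -> V) : (0 < M)%N ->
  \sum_(p : 'I_m.+1 * 'I_m.+1 |
    [&& 0 < p.1, 0 < p.2 & p.1 * p.2 == m]%N && (M %| p.2)%N) F (M * p.1)%N =
  \sum_(p : 'I_m.+1 * 'I_m.+1 |
    [&& 0 < p.1, 0 < p.2 & p.1 * p.2 == m]%N && (M %| p.2)%N) F p.2.
Proof.
move=> M0; pose P (p : 'I_m.+1 * 'I_m.+1) :=
  [&& 0 < p.1, 0 < p.2 & p.1 * p.2 == m]%N && (M %| p.2)%N.
change (\sum_(p | P p) F (M * p.1)%N = \sum_(p | P p) F p.2).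
pose h (p : 'I_m.+1 * 'I_m.+1) : 'I_m.+1 * 'I_m.+1 :=
  (inord (p.2 %/ M), inord (M * p.1)).
(* [h] is an involution on [P]: both u / M and M k are at most m, so [inord] alters neither. *)
have hE p : P p -> [/\ (h p).1 = (p.2 %/ M)%N :> nat, (h p).2 = (M * p.1)%N :> nat,
    P (h p) & h (h p) = p].
  case: p => a b /andP[/= /and3P[a0 b0 /eqP abm] /dvdnP[v Ev]].
  have v0 : (0 < v)%N by move: b0; rewrite Ev; case: (v).
  have lev : (v <= m)%N by nia.
  have leMa : (M * a <= m)%N by nia.
  have e1 : (h (a, b)).1 = v :> nat by rewrite /h /= Ev mulnK// inordK.
  have e2 : (h (a, b)).2 = (M * a)%N :> nat by rewrite /h /= inordK.
  split=> //; first by rewrite e1 /= Ev mulnK.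
    rewrite /P /= e1 e2 v0 muln_gt0 M0 a0 dvdn_mulr//= andbT.
    by rewrite mulnA -Ev mulnC abm.
  by rewrite {1}/h e1 e2 mulKn// mulnC -Ev !inord_val.
rewrite [LHS](reindex_onto h h) /=; last by move=> p /hE[].
apply: eq_big => [p|p /andP[Pp /eqP hp]]; last first.
  by have [_ + _ _] := hE _ Pp; rewrite hp => <-.
apply/andP/idP => [[Ph /eqP hp]|Pp].
  by have [_ _ + _] := hE _ Ph; rewrite hp.
by have [_ _ Ph hp] := hE _ Pp; split; [exact: Ph | apply/eqP].
Qed.

(** Summing the roots of unity leaves the pairs (k, u) with M | u, each with weight M. The claim
    then compares the sums of M k and of u over these pairs, which the swap identifies. *)
Lemma sum_f2_gtilde2 (R : realType) (n d m : nat) : (d %| n.+1)%N ->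
  (\sum_(a < n.+1 | (d %| a)%N) f2 R a m) *+ (n.+1 %/ d) =
  \sum_(a < n.+1 | (d %| a)%N) gtilde2 R a m.
Proof.
move=> dn; set M := (n.+1 %/ d)%N.
have M0 : (0 < M)%N.
  by rewrite (divn_gt0 _ (dvdn_gt0 (ltn0Sn n) dn)) (dvdn_leq (ltn0Sn n) dn).
have sumE (c : nat -> nat -> R[i]) :
    \sum_(a < n.+1 | (d %| a)%N)
      lambert (fun k u => eta R n.+1 ^+ (a * u) * c k u / n.+1%:R ^+ 2) m =
    \sum_(p : 'I_m.+1 * 'I_m.+1 |
        [&& 0 < p.1, 0 < p.2 & p.1 * p.2 == m]%N && (M %| p.2)%N)
      M%:R * c p.1 p.2 / n.+1%:R ^+ 2.
  under eq_bigr do rewrite lambertE.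
  rewrite exchange_big [RHS]big_mkcondr /=; apply: eq_bigr => p _.
  under eq_bigr do rewrite -mulrA.
  rewrite -mulr_suml sum_eta_dvd// -/M.
  by case: ifP => _; rewrite ?mul0r ?mulrA.
rewrite (sumE (fun k _ => k%:R)) (sumE (fun _ u => u%:R)).
rewrite -(sum_dvd_swap m (fun u => M%:R * u%:R / n.+1%:R ^+ 2) M0).
rewrite -sumrMnl; apply: eq_bigr => p _.
by rewrite -[LHS]mulr_natl natrM !mulrA.
Qed.

(** * The number of free variables *)

Lemma card_free (n : nat) :
  #|@free_index n| = (n.+1 * n %/ 2 + size (divisors n.+1))%N.
Proof.
pose D : pred ('I_n.+1 * 'I_n.+1) :=
  [pred p : 'I_n.+1 * 'I_n.+1 | has (fun d => (p.1 == n.+1 - d :> nat)%N &&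
                          (p.2 == n.+1 - d :> nat)%N) (divisors n.+1)].
pose L : pred ('I_n.+1 * 'I_n.+1) := [pred p : 'I_n.+1 * 'I_n.+1 | (p.2 < p.1)%N].
have -> : #|@free_index n| = (#|L| + #|D|)%N.
  rewrite -cardUI [X in (_ + X)%N]eq_card0 ?addn0; first exact: eq_card.
  move=> p; rewrite !inE; apply/negP => /andP[lt /hasP[d _ /andP[/eqP e1 /eqP e2]]].
  by move: lt; rewrite e1 e2 ltnn.
congr addn.
  rewrite -sum1_card -(pair_big_dep xpredT (fun a b : 'I_n.+1 => (b < a)%N)
    (fun _ _ => 1%N)) /=.
  have -> : (n.+1 * n %/ 2 = 'C(n.+1, 2))%N by rewrite bin2 divn2.
  rewrite -bin2_sum big_mkord; apply: eq_bigr => a _.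
  rewrite -(big_ord_widen n.+1 (fun=> 1%N) (ltnW (ltn_ord a))).
  by rewrite sum1_card card_ord.
(* The diagonal part is the injective image of the divisors; d > 0 makes N - d a valid
   representative. *)
pose g d : 'I_n.+1 * 'I_n.+1 := (inord (n.+1 - d), inord (n.+1 - d)).
have gE d : (d %| n.+1)%N -> (inord (n.+1 - d) : 'I_n.+1) = (n.+1 - d)%N :> nat.
  move=> dn; have d0 := dvdn_gt0 (ltn0Sn n) dn.
  by rewrite inordK//; lia.
rewrite -(size_map g); have /card_uniqP <- : uniq [seq g d | d <- divisors n.+1].
  rewrite map_inj_in_uniq ?divisors_uniq// => d e.
  rewrite -!dvdn_divisors// => dn en.
  move=> /(congr1 (fun p => val p.1)) /=; rewrite !gE//.
  have := dvdn_leq (ltn0Sn n) dn; have := dvdn_leq (ltn0Sn n) en; lia.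
apply: eq_card => -[a b]; rewrite !inE; apply/hasP/mapP => -[d dD].
  move=> /andP[/eqP /= ea /eqP eb]; have dn : (d %| n.+1)%N by rewrite dvdn_divisors.
  by exists d => //; congr pair; apply: ord_inj; rewrite gE.
move=> [-> ->]; exists d => //=.
by rewrite gE ?eqxx// dvdn_divisors.
Qed.

(** * Elimination of lambda, uniqueness and existence *)

Definition defect_rhs (R : realType) (n m : nat) (a b : 'I_n.+1) : R[i] :=
  f2 R a m + f2 R b m - (a == b)%:R * gtilde2 R a m *+ 2.

Lemma defect_rhsC (R : realType) (n m : nat) (a b : 'I_n.+1) :
  defect_rhs R m a b = defect_rhs R m b a.
Proof.
by rewrite /defect_rhs [f2 R b m + _]addrC; case: eqVneq => [->//|]; rewrite ?mul0r.
Qed.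

Lemma sum_defect_rhs (R : realType) (n m d : nat) : (d %| n.+1)%N ->
  \sum_(a < n.+1 | (d %| a)%N) \sum_(b < n.+1 | (d %| b)%N)
    defect_rhs R m a b = 0.
Proof.
move=> dn; have cardH (V : nmodType) (x : V) :
    \sum_(b < n.+1 | (d %| b)%N) x = x *+ (n.+1 %/ d).
  by rewrite sumr_const -(count_dvd_ord dn) sum1_card.
have diag (a : 'I_n.+1) : (d %| a)%N ->
    \sum_(b < n.+1 | (d %| b)%N) (a == b)%:R * gtilde2 R a m = gtilde2 R a m.
  move=> da; rewrite (bigD1 a da) /= eqxx mul1r big1 ?addr0//.
  by move=> b /andP[_ ba]; rewrite eq_sym (negbTE ba) mul0r.
under eq_bigr => a da do rewrite sumrB big_split cardH sumrMnl diag//.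
rewrite sumrB big_split cardH !sumrMnl sum_f2_gtilde2//= -mulr2n.
by rewrite subrr.
Qed.

(** The first two families of equations force this lambda; on the diagonal the mean is just gamma(a,
    a). Substituting it into the third family produces the diagonal term of [defect_rhs]. *)
Definition lambda_of (R : realType) (n : nat) (gamma : unknowns R n) :
    unknowns R n :=
  fun a b m => (gamma a b m + gamma b a m) / 2 - (a == b)%:R * gtilde2 R a m.

Lemma is_solutionP (R : realType) (n : nat) (gamma lambda : unknowns R n) :
  is_solution gamma lambda <-> lambda = lambda_of gamma /\
    forall m a b,
      defect (fun p => gamma p.1 p.2 m) a b = defect_rhs R m a b.
Proof.
have nz2 : (2 : R[i]) != 0 by rewrite pnatr_eq0.
split=> [[lC diag off add]|[-> eqs]].
  have lE : lambda = lambda_of gamma.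
    apply/funext => a; apply/funext => b; apply/funext => m; rewrite /lambda_of.
    have [<-|ab] := eqVneq a b.
      have /(congr1 (fun x => x m)) := diag a; rewrite /= => <-.
      rewrite mul1r.
      change ((gamma a a - lambda a a) m) with (gamma a a m - lambda a a m).
      by field.
    have /(congr1 (fun x => x m)) := off a b ab; rewrite mulr2n.
    change (gamma a b m + gamma b a m - (lambda a b m + lambda a b m) = 0 ->
      lambda a b m = (gamma a b m + gamma b a m) / 2 - 0 * gtilde2 R a m).
    by move/subr0_eq => ->; field.
  split=> // m a b; have /(congr1 (fun x => x m)) := add a b; rewrite mulr2n.
  change (gamma (a + b) a m + gamma (a + b) b m - (lambda a b m + lambda a b m)
    = f2 R a m + f2 R b m ->
    defect (fun p => gamma p.1 p.2 m) a b = defect_rhs R m a b).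
  by rewrite lE /lambda_of /defect_rhs => <-; rewrite /defect /=; field.
split=> [a b|a|a b ab|a b].
- apply/funext => m; rewrite /lambda_of eq_sym [gamma b a m + _]addrC.
  by have [->|] := eqVneq a b; rewrite ?mul0r.
- apply/funext => m; change (gamma a a m - lambda_of gamma a a m = gtilde2 R a m).
  by rewrite /lambda_of eqxx mul1r; field.
- apply/funext => m; rewrite mulr2n.
  change (gamma a b m + gamma b a m -
    (lambda_of gamma a b m + lambda_of gamma a b m) = 0).
  by rewrite /lambda_of (negbTE ab) mul0r; field.
apply/funext => m; rewrite mulr2n.
change (gamma (a + b) a m + gamma (a + b) b m -
  (lambda_of gamma a b m + lambda_of gamma a b m) = f2 R a m + f2 R b m).
have := eqs m a b; rewrite /defect_rhs /defect /lambda_of /= => E.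
by rewrite -[RHS](subrK ((a == b)%:R * gtilde2 R a m *+ 2)) -E; field.
Qed.

Lemma is_solution_unique (R : realType) (n : nat)
    (s t : unknowns R n * unknowns R n) :
  is_solution s.1 s.2 -> is_solution t.1 t.2 ->
  (forall a b : 'I_n.+1, free_index (a, b) -> s.1 a b = t.1 a b) -> s = t.
Proof.
case: s t => [g l] [g' l'] /= /is_solutionP[-> sg] /is_solutionP[-> sg'] gg'.
suff -> : g = g' by [].
apply/funext => a; apply/funext => b; apply/funext => m; apply: subr0_eq.
pose h (p : 'I_n.+1 * 'I_n.+1) : R[i] := g p.1 p.2 m - g' p.1 p.2 m.
apply: (@defect_kernel _ n h _ _ (a, b)) => -[c d].
  by move=> /gg' E; rewrite /h /= E subrr.
move=> _; rewrite -(subrr (defect_rhs R m c d)) -{1}sg -sg' /defect /h /=; ring.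
Qed.

Definition system_data (R : realType) (n : nat) (v : unknowns R n) (m : nat) :
    {ffun 'I_n.+1 * 'I_n.+1 -> R[i]^o} :=
  [ffun p => if free_index p then v p.1 p.2 m else defect_rhs R m p.1 p.2].

(** One operator [S] serves all data [v] and all coefficients m, so its matrix entries can serve as
    the constant coefficients of a linear combination of series. *)
Lemma solution_exists (R : realType) (n : nat) :
  exists S : 'End({ffun 'I_n.+1 * 'I_n.+1 -> R[i]^o}), forall v,
    let gamma : unknowns R n := fun a b m => S (system_data v m) (a, b) in
    is_solution gamma (lambda_of gamma) /\
    forall a b, free_index (a, b) -> gamma a b = v a b.
Proof.
have [S SP] := solution_operator R[i] n; exists S => v gamma; split; last first.
  by move=> a b fab; apply/funext => m; rewrite /gamma (SP _).1// ffunE fab.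
apply/is_solutionP; split=> // m.
pose h := (S (system_data v m) : 'I_n.+1 * 'I_n.+1 -> R[i]).
suff : forall a b, defect h a b = defect_rhs R m a b by [].
apply: defect_complete => [a b|d|p nfp]; first exact: defect_rhsC.
  exact: sum_defect_rhs.
by rewrite (SP _).2// ffunE (negbTE nfp).
Qed.

(** * Solutions in the span, and their infinitude *)

Lemma sum_delta (K : pzSemiRingType) (I : finType) (F : I -> K) (y : I) :
  \sum_x (x == y)%:R * F x = F y.
Proof.
rewrite (bigD1 y)//= eqxx mul1r big1 ?addr0// => x /negbTE->.
by rewrite mul0r.
Qed.

Lemma in_span_lambda_of (R : realType) (n : nat) (gamma : unknowns R n) a b :
  in_span_fg n (gamma a b) -> in_span_fg n (gamma b a) ->
  in_span_fg n (lambda_of gamma a b).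
Proof.
move=> [c [d E]] [c' [d' E']].
exists (fun x => (c x + c' x) / 2).
exists (fun x => (d x + d' x) / 2 - (a == b)%:R * (x == a)%:R) => m.
rewrite /lambda_of E E' -(sum_delta (fun x => gtilde2 R x m)).
rewrite -big_split /= mulr_suml mulr_sumr -sumrB.
by apply: eq_bigr => x _; field.
Qed.

Lemma in_span_solution (R : realType) (n : nat)
    (S : 'End({ffun 'I_n.+1 * 'I_n.+1 -> R[i]^o})) (t : R[i]) a b :
  in_span_fg n (fun m =>
    S (system_data (fun _ _ m => t * f2 R (0 : 'I_n.+1) m) m) (a, b)).
Proof.
(* [C x] and [D x] collect the coefficients of [f2] and [gtilde2] at x in the system data; neither
   depends on m, so [S] can be applied to them once and for all. *)
pose C x : {ffun 'I_n.+1 * 'I_n.+1 -> R[i]^o} := [ffun p =>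
  if free_index p then t * (x == 0)%:R else (x == p.1)%:R + (x == p.2)%:R].
pose D x : {ffun 'I_n.+1 * 'I_n.+1 -> R[i]^o} := [ffun p =>
  if free_index p then 0 else - ((p.1 == p.2)%:R * (x == p.1)%:R *+ 2)].
exists (fun x => S (C x) (a, b)), (fun x => S (D x) (a, b)) => m.
have -> : system_data (fun _ _ m => t * f2 R (0 : 'I_n.+1) m) m =
    \sum_x (f2 R x m *: C x + gtilde2 R x m *: D x).
  apply/ffunP => p; rewrite sum_ffunE !ffunE.
  under eq_bigr do rewrite !ffunE.
  case: ifP => _.
    rewrite -(sum_delta (fun x => f2 R x m) 0) mulr_sumr; apply: eq_bigr => x _.
    by rewrite scaler0 addr0 /GRing.scale /=; ring.
  rewrite /defect_rhs -(sum_delta (fun x => f2 R x m) p.1).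
  rewrite -(sum_delta (fun x => f2 R x m) p.2).
  rewrite -(sum_delta (fun x => gtilde2 R x m) p.1) mulr_sumr -sumrMnl -big_split -sumrB /=.
  by apply: eq_bigr => x _; rewrite /GRing.scale /=; ring.
rewrite linear_sum sum_ffunE; apply: eq_bigr => x _.
by rewrite linearD !linearZ !ffunE /GRing.scale /= mulrC [X in _ + X]mulrC.
Qed.

Theorem theorem8p1 (R : realType) (n : nat) :
  [/\ infinite_set [set s : unknowns R n * unknowns R n |
        is_solution s.1 s.2 /\
        forall a b : 'I_n.+1,
          in_span_fg n (s.1 a b) /\ in_span_fg n (s.2 a b)],
      #|@free_index n| = (n.+1 * n %/ 2 + size (divisors n.+1))%N
    & forall v : unknowns R n,
        exists! s : unknowns R n * unknowns R n,
          is_solution s.1 s.2 /\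
          forall a b : 'I_n.+1, free_index (a, b) -> s.1 a b = v a b].
Proof.
have [S SP] := solution_exists R n.
pose sol v : unknowns R n * unknowns R n :=
  let gamma : unknowns R n := fun a b m => S (system_data v m) (a, b) in
  (gamma, lambda_of gamma).
split; first 1 last.
- exact: card_free.
- move=> v; exists (sol v); split; first exact: SP.
  move=> s [s_sol sv].
  apply: (@is_solution_unique R n (sol v) s (SP v).1 s_sol) => a b fab.
  by rewrite sv//; apply: (SP v).2.
(* Setting every free variable to k times f_2^0 gives one solution per k. They differ at gamma(0,
   0), free because N | N, in the coefficient of q, where f_2^0 has the nonzero value 1/N^2. *)
pose v (k : nat) : unknowns R n := fun _ _ m => k%:R * f2 R (0 : 'I_n.+1) m.
set A := [set s | _]; apply/infiniteP.
suff [inj_sol] : $|{injfun [set: nat] >-> A}| by exact: inj_card_le inj_sol.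
apply/injfunPex; exists (sol \o v) => [k _|j k _ _].
  split; first exact: (SP (v k)).1.
  by move=> a b; split; last apply: in_span_lambda_of; apply: in_span_solution.
move=> /(congr1 (fun s => s.1 0 0 1%N)) /=.
have free00 : free_index (0 : 'I_n.+1, 0 : 'I_n.+1).
  by apply/free_diagP; exists n.+1; rewrite // subnn.
have vE l : S (system_data (v l) 1) (0, 0) = v l 0 0 1%N.
  by rewrite -((SP (v l)).2 0 0 free00).
have f1 : f2 R (0 : 'I_n.+1) 1 = (n.+1%:R ^+ 2)^-1.
  by rewrite /f2 /lambert big_nat1 big_mkcond big_nat1 /= mul0n expr0 !mul1r.
rewrite !vE /v f1 => /mulIf E; apply/eqP; rewrite -(eqr_nat R[i]).
by apply/eqP/E; rewrite invr_eq0 expf_neq0 ?pnatr_eq0.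
Qed.
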